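(* Any shortest basis generates a Riesz basis. That is, let $N\ge1$ and $M\ge0$ be integers and let $\boldsymbol{\phi}=(\phi_1,\ldots,\phi_N)\in(L_2(\mathbb{R}))^N$. If $\boldsymbol{\phi}$ is a shortest-support basis of degree $M$, then $\boldsymbol{\phi}$ generates a Riesz basis.
   Context: Support: $\mathrm{supp}(f)=\overline{\{x\in\mathbb{R}:f(x)\ne0\}}$; for compactly supported $f$, the support size $|f|$ is the Lebesgue measure of $\mathrm{supp}(f)$; for a collection of compactly supported functions, $|\boldsymbol{\phi}|=\sum_{n=1}^N|\phi_n|$. Let $\mathrm{S}(\boldsymbol{\phi})=\sum_{n=1}^N\overline{\mathrm{Span}}\{\phi_n(\cdot-k):k\in\mathbb{Z}\}\subseteq L_2(\mathbb{R})$. ''$\mathrm{S}(\boldsymbol{\phi})$ reproduces polynomials of degree up to $M$'' means that for every $m=0,\ldots,M$ there exist scalar sequences $c_{m,1},\ldots,c_{m,N}$ on $\mathbb{Z}$ (not necessarily in $\ell_2$) such that for all $x\in\mathbb{R}$, $x^m=\sum_{k\in\mathbb{Z}}\sum_{n=1}^N c_{m,n}[k]\phi_n(x-k)$ (with $x^0=1$, including at $x=0$). Shortest-support basis of degree $M$ (also ''shortest basis''): a collection $\boldsymbol{\phi}\in(L_2(\mathbb{R}))^N$ of compactly supported functions such that $\mathrm{S}(\boldsymbol{\phi})$ reproduces polynomials of degree up to $M$ with the shortest support, i.e. with $|\boldsymbol{\phi}|=M+1$. ''$\boldsymbol{\phi}$ generates a Riesz basis'' means that there are constants $0<A\le B<+\infty$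 such that for all square-summable scalar sequences $c_1,\ldots,c_N\in\ell_2(\mathbb{Z})$, $$A\Big(\sum_{n=1}^N\|c_n\|_{\ell_2}^2\Big)^{1/2}\le\Big\|\sum_{k\in\mathbb{Z}}\sum_{n=1}^N c_n[k]\phi_n(\cdot-k)\Big\|_{L_2(\mathbb{R})}\le B\Big(\sum_{n=1}^N\|c_n\|_{\ell_2}^2\Big)^{1/2}.$$
   Formalization: Each φ_n is additionally assumed not almost everywhere zero; without this the claim fails, e.g. N=2, M=0, φ_1 the indicator of [0,1), φ_2=0 is a shortest basis but violates the lower Riesz bound. *)

(* Defs.v *)
From HB Require Import structures.
From mathcomp Require Import all_boot all_order all_algebra.
From mathcomp Require Import complex.
From mathcomp Require Import all_classical all_reals all_analysis.

Set Implicit Arguments.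
Unset Strict Implicit.
Unset Printing Implicit Defensive.

Import Order.TTheory GRing.Theory Num.Theory.
Import numFieldTopology.Exports.
Import numFieldNormedType.Exports.

Local Open Scope classical_set_scope.
Local Open Scope ring_scope.
Local Open Scope complex_scope.

(* Scalars are complex; the case of real-valued functions with real
   coefficient sequences is contained in it through the embedding x |-> x%:C. *)

(* The carrier R with its Lebesgue (Caratheodory) sigma-algebra: the default
   measurable structure on R is only the Borel one. *)
Definition lebesgueR (R : realType) :=
  caratheodory_type (R := R) (wlength idfun)^*%mu.

Definition L2norm (R : realType) (f : R -> R[i]) : \bar R :=
  Lnorm (T := lebesgueR R) completed_lebesgue_measure 2%:E
    (fun x => (Normc.normc (f x))%:E).

Definition in_L2 (R : realType) (f : R -> R[i]) : Prop :=
  [/\ measurable_fun [set: lebesgueR R] (fun x : lebesgueR R => complex.Re (f x)),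
      measurable_fun [set: lebesgueR R] (fun x : lebesgueR R => complex.Im (f x)) &
      (L2norm f < +oo)%E].

(* Being nonzero as an element of L2, i.e. modulo almost-everywhere equality.
   The support condition |phi| = M + 1 allows null members (adding the zero
   function to a family changes neither its support size nor its span), and
   such a family never satisfies the lower Riesz bound. *)
Definition nonzero_in_L2 (R : realType) (f : R -> R[i]) : Prop :=
  ~ {ae @lebesgue_measure R, forall x : R, f x = 0}.

Definition supp (R : realType) (f : R -> R[i]) : set R :=
  closure [set x : R | f x != 0].

Definition compactly_supported (R : realType) (f : R -> R[i]) : Prop :=
  compact (supp f).

Definition support_size (R : realType) (N : nat) (phi : 'I_N -> R -> R[i]) :
    \bar R :=
  (\sum_(n < N) lebesgue_measure (supp (phi n)))%E.

(* For compactly supported phi only finitely many k contribute at a given x, so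
   this finitely supported sum over the integers is the pointwise sum of the
   series for arbitrary coefficients; for square-summable coefficients it is
   also the sum of the series in L2. *)
Definition shift_comb (R : realType) (N : nat) (phi : 'I_N -> R -> R[i])
    (c : 'I_N -> int -> R[i]) (x : R) : R[i] :=
  \sum_(k \in [set: int]) \sum_(n < N) c n k * phi n (x - k%:~R).

Definition reproduces_polynomials (R : realType) (N : nat)
    (phi : 'I_N -> R -> R[i]) (M : nat) : Prop :=
  forall m : nat, (m <= M)%N ->
    exists c : 'I_N -> int -> R[i],
      forall x : R, (x ^+ m)%:C = shift_comb phi c x.

Definition shortest_support_basis (R : realType) (N : nat)
    (phi : 'I_N -> R -> R[i]) (M : nat) : Prop :=
  [/\ forall n, in_L2 (phi n),
      forall n, compactly_supported (phi n),
      reproduces_polynomials phi M &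
      support_size phi = (M.+1%:R)%:E].

Definition ell2_sqnorm (R : realType) (c : int -> R[i]) : \bar R :=
  \esum_(k in [set: int]) (Normc.normc (c k) ^+ 2)%:E.

Definition in_ell2 (R : realType) (c : int -> R[i]) : Prop :=
  (ell2_sqnorm c < +oo)%E.

Definition ell2_norm (R : realType) (c : int -> R[i]) : R :=
  Num.sqrt (fine (ell2_sqnorm c)).

Definition generates_Riesz_basis (R : realType) (N : nat)
    (phi : 'I_N -> R -> R[i]) : Prop :=
  exists A B : R,
    [/\ 0 < A, A <= B &
        forall c : 'I_N -> int -> R[i], (forall n, in_ell2 (c n)) ->
          ((A * Num.sqrt (\sum_(n < N) ell2_norm (c n) ^+ 2))%:E
             <= L2norm (shift_comb phi c))%E /\
          (L2norm (shift_comb phi c)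
             <= (B * Num.sqrt (\sum_(n < N) ell2_norm (c n) ^+ 2))%:E)%E].

(* Main.v *)
From HB Require Import structures.
Require Import Defs.
From mathcomp Require Import all_boot all_order all_algebra.
From mathcomp Require Import complex.
From mathcomp Require Import all_classical all_reals all_analysis.
From mathcomp Require Import measurable_realfun zify ring lra.

(** Why a shortest basis generates a Riesz basis.

    Let f be a combination of the integer shifts of the phi_n.  For x in [0,1)
    and j an integer, f(x - j) is a finite combination of the functions psi_t(x) = phi_n(x - k), where t = (n, k) ranges over a
    finite index set that does not depend on j.  Since the integral of |f|^2
    over the line is the sum over j of the integrals of |f(x - j)|^2 over
    [0,1) ([integral_unit_partition]), everything reduces to the finite family
    psi on [0,1).

    Partition [0,1) into the cells on which the set A of active indices (those
    t with x in the support of psi_t) is constant.  On a cell of positive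
    measure the linearly independent monomials 1, x, ..., x^M are combinations
    of the psi_t with t in A, so that #A >= M + 1
    ([coefficient_matrix_row_free]).  The mean of #A over [0,1) is the total
    support size, which is M + 1; hence #A = M + 1 on every cell of positive
    measure ([card_active]).  There the coefficient matrix of the monomials is
    square and invertible, so any combination of the psi_t is a polynomial of
    degree at most M whose coefficients control those of the combination.  The
    square integral of a polynomial over a set of positive measure is a
    positive definite quadratic form in its coefficients
    ([row_poly_lower_bound]), hence the local lower bound
    ([local_lower_bound]).  As phi_n is not negligible, each n has a shift
    that is active on some cell of positive measure; summing the local bound
    over j gives the lower Riesz inequality for the coefficients of phi_n.
    The upper inequality is the Cauchy-Schwarz inequality on [0,1), summed
    over j ([integral_sqr_normc_comb_le], [upper_bound]). *)

Set Implicit Arguments.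
Unset Strict Implicit.
Unset Printing Implicit Defensive.

Import Order.TTheory GRing.Theory Num.Theory.
Import numFieldTopology.Exports.
Import numFieldNormedType.Exports.

Local Open Scope classical_set_scope.
Local Open Scope ring_scope.
Local Open Scope complex_scope.

(** * Translations and the partition of the line into unit intervals *)

Section translation.
Context {R : realType}.
Notation T := (lebesgueR R).
Notation nu := (@completed_lebesgue_measure R).

Lemma itv_oc_shift (a b c : R) :
  (fun x : R => x + c) @^-1` `]a, b] = `]a - c, b - c]%classic.
Proof. by apply/seteqP; split=> x /=; rewrite !in_itv/= ltrBlDr lerBrDr. Qed.

Lemma wlength_shift (c : R) (X : set R) : ocitv X ->
  ocitv ((fun x : R => x + c) @^-1` X) /\
  wlength idfun ((fun x : R => x + c) @^-1` X) = wlength idfun X.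
Proof.
move/ocitvP=> [->|[[a b] /= ab ->]].
  by rewrite preimage_set0; split => //; exact: ocitv0.
rewrite itv_oc_shift; split; first exact: is_ocitv.
rewrite !wlength_itv_bnd ?lerD2r ?ltW//=.
by congr (_%:E); rewrite opprB addrA subrK.
Qed.

(** The outer measure is an infimum over covers by half-open intervals, and
    translating a cover does not change its total length. *)
Lemma le_completed_lebesgue_shift (c : R) (X : set R) :
  (nu ((fun x : R => x + c)%R @^-1` X) <= nu X)%E.
Proof.
apply: le_ereal_inf => _ [A [mA XA] <-].
exists (fun k => (fun x : R => x + c) @^-1` (A k)).
  split; first by move=> k; have [] := wlength_shift c (mA k).
  by move=> x /= /XA [k _ Ak]; exists k.
by apply: eq_eseriesr => k _; exact: (wlength_shift c (mA k)).2.
Qed.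

Lemma completed_lebesgue_shift (c : R) (X : set R) :
  nu ((fun x : R => x + c) @^-1` X) = nu X.
Proof.
apply/eqP; rewrite eq_le le_completed_lebesgue_shift/=.
have := le_completed_lebesgue_shift (- c) ((fun x : R => x + c) @^-1` X).
congr (nu _ <= _)%E; apply/seteqP.
by split => x /=; rewrite subrK.
Qed.

(** Measurability is the Caratheodory condition here, which only mentions the
    outer measure. *)
Lemma measurable_shift (c : R) (X : set T) :
  measurable X -> measurable ((fun x : R => x + c) @^-1` X : set T).
Proof.
move=> mX.
have {}mX : forall Y, nu Y = (nu (Y `&` X) + nu (Y `&` ~` X))%E := mX.
suff : forall Y, nu Y = (nu (Y `&` (fun x : R => x + c)%R @^-1` X) +
                    nu (Y `&` ~` ((fun x : R => x + c)%R @^-1` X)))%E by [].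
move=> Y.
have E : Y = (fun x : R => x + c) @^-1` ((fun x : R => x - c) @^-1` Y).
  by apply/seteqP; split => x /=; rewrite addrK.
rewrite E preimage_setC -!preimage_setI !(completed_lebesgue_shift c).
exact: mX.
Qed.

Lemma measurable_fun_shift d (U : measurableType d) (c : R) (D : set T) (f : T -> U) :
  measurable_fun D f -> measurable_fun ((fun x : R => x + c) @^-1` D : set T)
     (fun x : T => f ((x : R) + c)).
Proof.
move=> mf mD Y mY.
have mD' : measurable D.
  have := measurable_shift (- c) mD; congr measurable; apply/seteqP.
  by split => x /=; rewrite subrK.
exact: (measurable_shift c (mf mD' Y mY)).
Qed.

Local Open Scope ereal_scope.

Lemma integral_shift (c : R) (D : set T) (f : T -> \bar R) :
  measurable D -> measurable_fun D f -> (forall x, 0 <= f x) ->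
  \int[nu]_(x in (fun x : R => x + c)%R @^-1` D) f ((x : R) + c)%R =
  \int[nu]_(x in D) f x.
Proof.
move=> mD mf f0.
have ms : measurable_fun [set: T] (fun x : T => ((x : R) + c)%R : T).
  move=> _ Y mY; rewrite setTI; exact: measurable_shift.
rewrite -(@ge0_integral_pushforward _ _ _ _ _ _ ms nu D f)//.
apply: eq_measure_integral => A mA _.
exact: completed_lebesgue_shift.
Qed.

(** The enumeration 0, -1, 1, -2, 2, ... of the integers. *)
Definition int_enum (n : nat) : int := if odd n then Negz n./2 else Posz n./2.

Lemma int_enum_bij : set_bij [set: nat] [set: int] int_enum.
Proof.
split=> //.
- move=> m n _ _ mn; move: mn (odd_double_half m) (odd_double_half n).
  rewrite /int_enum.
  by case: (odd m); case: (odd n) => // mn; injection mn => -> <-.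
- move=> [n|n] _.
    by exists n.*2 => //; rewrite /int_enum odd_double doubleK.
  exists n.*2.+1 => //.
  by rewrite /int_enum /= odd_double/= uphalf_double.
Qed.

(** The interval [0,1), the fundamental domain of the integer translations. *)
Definition unit_itv : set T := `[0%R, 1%R[.

Lemma borel_lebesgueR (X : set R) : measurable X -> measurable (X : set T).
Proof. exact: sub_caratheodory. Qed.

Lemma measurable_unit_itv : measurable unit_itv.
Proof. by apply: borel_lebesgueR; exact: measurable_itv. Qed.

(** Every real x lies in exactly one integer translate of [0,1). *)
Lemma unit_itv_shiftP (j : int) (x : R) :
  ((fun x : R => x + j%:~R)%R @^-1` unit_itv) x <-> j = (- Num.floor x)%R.
Proof.
rewrite /unit_itv /= in_itv/=; split => [/andP[h0 h1]|->].
  rewrite -[j in LHS]opprK; congr (- _)%R; apply/esym/floor_def.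
  by rewrite intrD rmorphN/=; apply/andP; split; lra.
rewrite rmorphN/= subr_ge0 ge_floor/= ltrBlDr addrC.
by rewrite -[X in (_ + X)%R]/(1%:~R) -intrD floorD1_gt.
Qed.

(** The integer translates of [0,1), enumerated by the naturals. *)
Let unit_translate k : set T :=
  (fun x : R => x + (int_enum k)%:~R)%R @^-1` unit_itv.

Let measurable_unit_translate k : measurable (unit_translate k).
Proof. exact/measurable_shift/measurable_unit_itv. Qed.

Let bigcup_unit_translate : \bigcup_k unit_translate k = setT.
Proof.
have [_ _ surje] := int_enum_bij.
apply/seteqP; split => // x _.
have [k _ kx] := surje (- Num.floor (x : R))%R I.
by exists k => //; apply/unit_itv_shiftP.
Qed.

Let trivIset_unit_translate : trivIset setT unit_translate.
Proof.
have [_ inje _] := int_enum_bij.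
apply/trivIsetP => i j _ _ ij; apply/seteqP; split => // x [] /=.
move=> /unit_itv_shiftP hi /unit_itv_shiftP hj.
by move/eqP : ij; apply; apply: inje; rewrite ?inE// hi hj.
Qed.

Lemma measurable_fun_unit_translates d (U : measurableType d) (f : T -> U) :
  (forall j : int, measurable_fun unit_itv (fun x : T => f ((x : R) - j%:~R)%R)) ->
  measurable_fun setT f.
Proof.
move=> mf; rewrite -bigcup_unit_translate.
apply/measurable_fun_bigcup => // k.
have := measurable_fun_shift (c := (int_enum k)%:~R%R) (mf (int_enum k)).
by apply: eq_measurable_fun => x _ /=; rewrite addrK.
Qed.

Lemma integral_unit_partition (f : T -> \bar R) :
  measurable_fun setT f -> (forall x, 0 <= f x) ->
  \int[nu]_x f x = \esum_(j in [set: int]) \int[nu]_(x in unit_itv) f ((x : R) - j%:~R)%R.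
Proof.
move=> mf f0.
rewrite (reindex_esum _ _ _ _ int_enum_bij).
rewrite -nneseries_esumT; last by move=> k; exact: integral_ge0.
rewrite -bigcup_unit_translate ge0_integral_bigcup//; last first.
  by rewrite bigcup_unit_translate.
apply: eq_eseriesr => k _.
have mfk : measurable_fun [set: T] (fun x : T => f ((x : R) - (int_enum k)%:~R)%R).
  exact: (measurable_fun_shift (c := (- (int_enum k)%:~R)%R) mf).
rewrite -(@integral_shift (int_enum k)%:~R unit_itv); first last.
- by move=> x.
- exact: measurable_funS mfk.
- exact: measurable_unit_itv.
by apply: eq_integral => x _; rewrite addrK.
Qed.

Lemma esum_intZl (a : int -> \bar R) (r : R) : (0 <= r)%R -> (forall j, 0 <= a j) ->
  \esum_(j in [set: int]) (r%:E * a j) = r%:E * \esum_(j in [set: int]) a j.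
Proof.
move=> r0 a0; rewrite !(reindex_esum _ _ _ _ int_enum_bij).
rewrite -!nneseries_esumT//; last by move=> k; rewrite mule_ge0.
by rewrite nneseriesZl.
Qed.

End translation.

(** * Positive definite quadratic forms *)

Section quadratic_form.
Context {R : realType}.

Lemma continuous_sumr (I : Type) (r : seq I) (P : pred I) (T : topologicalType)
    (F : I -> T -> R) : (forall i, P i -> continuous (F i)) ->
  continuous (fun x => \sum_(i <- r | P i) F i x).
Proof. by apply: continuous_big; exact: add_continuous. Qed.

Lemma continuous_mulr (T : topologicalType) (f g : T -> R) :
  continuous f -> continuous g -> continuous (fun x => f x * g x).
Proof.
move=> cf cg a; apply: (@continuousM _ _ f g a); [exact: cf|exact: cg].
Qed.

Lemma quadratic_form_continuous n (G : 'M[R]_n) :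
  continuous (fun a : 'rV[R]_n => \sum_i \sum_j a ord0 i * a ord0 j * G i j).
Proof.
apply: continuous_sumr => i _; apply: continuous_sumr => j _.
apply: continuous_mulr; last by move=> b; exact: cst_continuous.
by apply: continuous_mulr => c; exact: coord_continuous.
Qed.

(** A positive definite quadratic form on R^n attains a positive minimum on
    the Euclidean unit sphere, which is compact; homogeneity does the rest. *)
Lemma posdef_form_lower_bound n (G : 'M[R]_n) :
  (forall a : 'rV[R]_n, a != 0 ->
     0 < \sum_i \sum_j a ord0 i * a ord0 j * G i j) ->
  exists2 alpha : R, 0 < alpha & forall a : 'rV[R]_n,
    alpha * (\sum_i a ord0 i ^+ 2) <= \sum_i \sum_j a ord0 i * a ord0 j * G i j.
Proof.
set q := fun a : 'rV[R]_n => \sum_i \sum_j a ord0 i * a ord0 j * G i j.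
set s := fun a : 'rV[R]_n => \sum_i a ord0 i ^+ 2 => q_gt0.
have s_ge0 a : 0 <= s a by apply: sumr_ge0 => i _; exact: sqr_ge0.
have sZ k a : s (k *: a) = k ^+ 2 * s a.
  by rewrite /s mulr_sumr; apply: eq_bigr => i _; rewrite mxE exprMn.
have qZ k a : q (k *: a) = k ^+ 2 * q a.
  rewrite /q mulr_sumr; apply: eq_bigr => i _; rewrite mulr_sumr.
  by apply: eq_bigr => j _; rewrite !mxE; ring.
have s_eq0 a : s a = 0 -> a = 0.
  move=> /eqP; rewrite /s psumr_eq0 => [/allP h|i _]; last exact: sqr_ge0.
  apply/rowP => i; rewrite mxE; apply/eqP; rewrite -sqrf_eq0.
  by apply: h; rewrite mem_index_enum.
have s0 : s 0 = 0 by rewrite -(scale0r 0) sZ expr0n/= mul0r.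
have q0 : q 0 = 0 by rewrite -(scale0r 0) qZ expr0n/= mul0r.
have cs : continuous s.
  apply: continuous_sumr => i _ a.
  apply: (@cvg_comp _ _ _ (fun M : 'rV[R]_n => M ord0 i) (fun x => x ^+ 2)).
    exact: coord_continuous.
  exact: exprn_continuous.
pose A := [set a | s a = 1].
(* The sphere A is empty only when the zero vector is the only one. *)
have [A0|/set0P/negP/negPn/eqP A0] := pselect (A !=set0); last first.
  exists 1 => // a; rewrite -/(s a) -/(q a); suff -> : a = 0.
    by rewrite s0 q0 mulr0.
  apply: s_eq0; apply/eqP/negPn/negP => sa0.
  suff : A ((Num.sqrt (s a))^-1 *: a) by rewrite A0.
  by rewrite /A/= sZ exprVn sqr_sqrtr// mulVf.
have cA : compact A.
  have cube : compact [set v : 'rV[R]_n | forall i, v ord0 i \in `[-1, (1:R)]].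
    apply: (@rV_compact _ _ (fun=> `[-1, (1:R)]%classic)).
    by move=> _; exact: segment_compact.
  apply: subclosed_compact cube _.
    rewrite (_ : A = s @^-1` [set 1])//.
    apply: preimage_closed; first by move=> x _; exact: cs.
    exact: closed_eq.
  move=> a /= sa i; rewrite in_itv/= -ler_norml.
  rewrite -[leLHS]ger0_norm// -(@ler_pXn2r _ 2)// ?nnegrE// expr1n -[leRHS]sa.
  rewrite real_normK ?num_real// real_normK ?num_real// /s (bigD1 i)//= lerDl.
  by apply: sumr_ge0 => j _; exact: sqr_ge0.
have [] := @EVT_min_rV _ _ q A A0 cA.
  by apply: continuous_subspaceT; exact: quadratic_form_continuous.
move=> c /[!inE] sc cmin.
have c0 : c != 0.
  apply/eqP => c0; move: sc; rewrite /A /= c0 s0.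
  by move/eqP; rewrite eq_sym oner_eq0.
exists (q c); first exact: q_gt0.
move=> a; have [->|a0] := eqVneq a 0.
  by rewrite -/(s 0) -/(q 0) s0 q0 mulr0.
rewrite -/(s a) -/(q a).
have sa0 : 0 < s a.
  by rewrite lt_neqAle s_ge0 andbT eq_sym; apply: contra a0 => /eqP/s_eq0 ->.
have : A ((Num.sqrt (s a))^-1 *: a).
  by rewrite /A/= sZ exprVn sqr_sqrtr// mulVf// gt_eqF.
rewrite -inE => /cmin; rewrite qZ exprVn sqr_sqrtr//.
by rewrite mulrC ler_pdivlMr.
Qed.

End quadratic_form.

(** * Square integrals of polynomials over sets of positive measure *)

Section polynomial_lower_bound.
Context {R : realType}.
Notation T := (lebesgueR R).
Notation nu := (@completed_lebesgue_measure R).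

Lemma borel_measurable_fun_lebesgueR d (U : measurableType d) (f : R -> U) :
  measurable_fun [set: R] f -> measurable_fun [set: T] (f : T -> U).
Proof.
move=> mf _ Y mY; apply: borel_lebesgueR.
exact: (mf measurableT Y mY).
Qed.

Lemma completed_lebesgue_finite0 (A : set R) : finite_set A -> nu A = 0%E.
Proof. by move=> fA; apply: countable_lebesgue_measure0; exact: finite_set_countable. Qed.

Lemma unit_itv_measure : nu (@unit_itv R) = 1%E.
Proof.
have := @lebesgue_measure_itv R `[0, 1[; rewrite /= lte_fin ltr01 oppr0 adde0.
by [].
Qed.

Lemma finite_horner_zeros (p : {poly R}) : p != 0 -> finite_set [set x | p.[x] = 0].
Proof.
move=> p0; apply: contrapT => /infinite_set_fset => /(_ (size p)) [B BA].
rewrite leqNgt => /negP; apply.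
apply: max_poly_roots => //; last exact: finmap.fset_uniq.
by apply/allP => x xB; apply/eqP; exact: BA.
Qed.

(** The polynomial function with coefficients a 0, ..., a (n - 1); the exponent
    is the index of the coefficient. *)
Definition row_poly n (a : 'I_n -> R) (x : R) := \sum_i a i * x ^+ i.

Lemma measurable_row_poly n (a : 'I_n -> R) (D : set T) :
  measurable_fun D (row_poly a : T -> R).
Proof.
apply: measurable_funTS.
apply: borel_measurable_fun_lebesgueR; apply: measurable_sum => i.
by apply: measurable_funM => //; exact: measurable_funX.
Qed.

Lemma finite_row_poly_zeros n (a : 'I_n -> R) :
  a != (fun=> 0) -> finite_set [set x | row_poly a x = 0].
Proof.
move=> a0; pose p := \poly_(i < n) (if insub i is Some j then a j else 0).
have pE x : p.[x] = row_poly a x.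
  by rewrite horner_poly; apply: eq_bigr => i _; rewrite valK.
rewrite (_ : [set x | _] = [set x | p.[x] = 0]); last first.
  by apply/seteqP; split => x /=; rewrite pE.
apply: finite_horner_zeros; apply: contra a0 => /eqP p0; apply/eqP/funext => i.
have := coef_poly n (fun i => if insub i is Some j then a j else 0) i.
by rewrite -/p p0 coef0 ltn_ord valK.
Qed.

(** The quadratic form is given by the moment matrix of E.  It is positive
    definite because a nonzero polynomial has finitely many zeros, while E has
    positive measure. *)
Lemma row_poly_lower_bound n (E : set T) : measurable E -> E `<=` unit_itv ->
  (0 < nu E)%E ->
  exists2 alpha : R, 0 < alpha & forall a : 'I_n -> R,
    ((alpha * \sum_i a i ^+ 2)%:E <= \int[nu]_(x in E) (row_poly a x ^+ 2)%:E)%E.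
Proof.
move=> mE E01 E0.
have nuE : (nu E < +oo)%E.
  apply: (@le_lt_trans _ _ (nu (@unit_itv R))); last by rewrite unit_itv_measure ltry.
  by apply: le_measure => //; rewrite inE//; exact: measurable_unit_itv.
have imon k : nu.-integrable E (fun x : T => ((x : R) ^+ k)%:E).
  apply: (measurable_bounded_integrable (f := fun x : T => (x : R) ^+ k) mE nuE).
    apply: measurable_funTS.
    by apply: borel_measurable_fun_lebesgueR; exact: exprn_measurable.
  exists 1; split => // y y1 x /E01; rewrite /unit_itv /= in_itv/= => /andP[x0 x1].
  rewrite ger0_norm ?exprn_ge0// (le_trans _ (ltW y1))// exprn_ile1//.
  exact: ltW.
pose G : 'M[R]_n := \matrix_(i, j) fine (\int[nu]_(x in E) (x ^+ (i + j))%:E)%E.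
have GE (a : 'I_n -> R) : (\int[nu]_(x in E) (row_poly a x ^+ 2)%:E)%E =
    (\sum_i \sum_j a i * a j * G i j)%:E.
  under eq_integral => x _.
    have -> : (row_poly a x ^+ 2)%:E =
       (\sum_(p : 'I_n * 'I_n) ((a p.1 * a p.2)%:E * (x ^+ (p.1 + p.2))%:E))%E.
      under eq_bigr do rewrite -EFinM.
      rewrite sumEFin -(pair_bigA _ (fun i j => a i * a j * x ^+ (i + j))) /=.
      congr (_%:E); rewrite expr2 {1}/row_poly mulr_suml; apply: eq_bigr => i _.
      by rewrite mulr_sumr; apply: eq_bigr => j _; rewrite exprD; ring.
    over.
  rewrite integral_sum//; last first.
    by move=> p; apply: integrableZl => //; exact: imon.
  rewrite pair_bigA/= -sumEFin; apply: eq_bigr => p _.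
  rewrite integralZl//.
  by rewrite [RHS]EFinM /G mxE fineK//; exact: integrable_fin_num.
have [] := @posdef_form_lower_bound R n G.
  move=> a a0; rewrite -lte_fin -(GE (fun i => a ord0 i)).
  rewrite lt0e integral_ge0 ?andbT; last by move=> x _; rewrite lee_fin sqr_ge0.
  apply/negP => /eqP I0.
  have mr : measurable_fun E (fun x : T => (row_poly (fun i => a ord0 i) x ^+ 2)%:E).
    by apply/measurable_EFinP; apply: measurable_funX; exact: measurable_row_poly.
  have : (\int[nu]_(x in E) `|(row_poly (fun i => a ord0 i) x ^+ 2)%:E| = 0)%E.
    rewrite -I0; apply: eq_integral => x _.
    by rewrite gee0_abs// lee_fin sqr_ge0.
  move/(ae_eq_integral_abs _ mE mr) => -[N [mN N0 sN]].
  have fz : finite_set [set x | row_poly (fun i => a ord0 i) x = 0].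
    apply: finite_row_poly_zeros; apply: contra a0 => /eqP h.
    by apply/eqP/rowP => i; rewrite mxE -(congr1 (fun f => f i) h).
  set Z := [set x : R | _] in fz.
  have mZ : measurable (Z : set T).
    apply: borel_lebesgueR; apply: countable_measurable => [t|].
      exact: measurable_set1.
    exact: finite_set_countable.
  have EZN : (E : set R) `<=` Z `|` N.
    move=> x Ex; have [Zx|Zx] := pselect (Z x); [by left|right].
    apply: sN => /= /(_ Ex) [] /eqP; rewrite sqrf_eq0 => /eqP.
    exact: Zx.
  have : (nu E <= nu ((Z : set T) `|` N))%E.
    by apply: le_measure; rewrite ?inE//; exact: measurableU.
  have ZN : (nu ((Z : set T) `|` N) <= nu Z + nu N)%E by exact: measureU2.
  have {}N0 : nu N = 0%E := N0.
  move=> /le_trans /(_ ZN).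
  by rewrite N0 adde0 (completed_lebesgue_finite0 fz) leNgt E0.
move=> alpha alpha0 h; exists alpha => // a; rewrite GE lee_fin.
have := h (\row_i a i).
congr (alpha * _ <= _); apply: eq_bigr => i _; rewrite ?mxE//.
by apply: eq_bigr => j _; rewrite mxE mxE.
Qed.

End polynomial_lower_bound.

(** * Finite sums and the rank of the coefficient matrix *)

Section finite_measure.
Context d (T : measurableType d) (R : realType) (mu : {measure set T -> \bar R}).

Lemma measure_finType_bigcup (J : finType) (P : pred J) (F : J -> set T) :
  (forall j, measurable (F j)) -> trivIset setT F ->
  (mu (\bigcup_(j in [set j | P j]) F j) = \sum_(j | P j) mu (F j))%E.
Proof.
move=> mF tF; rewrite measure_fin_bigcup//; last 2 first.
- exact: finite_finset.
- exact: sub_trivIset tF.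
rewrite (fsbigE (enum P)) ?enum_uniq//.
- rewrite -big_enum /= big_seq_cond [RHS]big_seq; apply: eq_bigl => j.
  rewrite mem_enum; case: (boolP (j \in P)) => //= jP.
  by apply/mem_set.
- by move=> j /=; rewrite mem_enum.
- by move=> j /= Pj; rewrite mem_enum unfold_in Pj.
Qed.

End finite_measure.

Section real_complex_sums.
Context {R : realType}.
Notation normc := (@Normc.normc R).

Lemma normc_ge0 (z : R[i]) : 0 <= normc z.
Proof. by case: z => a b /=; exact: sqrtr_ge0. Qed.

Lemma sqr_normcE (z : R[i]) : normc z ^+ 2 = complex.Re z ^+ 2 + complex.Im z ^+ 2.
Proof. by case: z => a b /=; rewrite sqr_sqrtr// addr_ge0 ?sqr_ge0. Qed.

Lemma normc_sum_le (I : Type) (r : seq I) (F : I -> R[i]) :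
  normc (\sum_(i <- r) F i) <= \sum_(i <- r) normc (F i).
Proof.
elim/big_ind2 : _ => //; first by rewrite Normc.normc0.
by move=> x a y b xa yb; rewrite (le_trans (le_normcD _ _))// lerD.
Qed.

(** Through the Lagrange identity. *)
Lemma cauchy_schwarz_sum (I : finType) (x y : I -> R) :
  (\sum_i x i * y i) ^+ 2 <= (\sum_i x i ^+ 2) * (\sum_i y i ^+ 2).
Proof.
rewrite -subr_ge0 -(@pmulr_rge0 _ 2)//.
suff -> : 2 * ((\sum_i x i ^+ 2) * (\sum_i y i ^+ 2) - (\sum_i x i * y i) ^+ 2) =
    \sum_i \sum_j (x i * y j - x j * y i) ^+ 2.
  by apply: sumr_ge0 => i _; apply: sumr_ge0 => j _; exact: sqr_ge0.
transitivity (\sum_i \sum_j (x i ^+ 2 * y j ^+ 2) + \sum_i \sum_j (y i ^+ 2 * x j ^+ 2)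
   - 2 * \sum_i \sum_j ((x i * y i) * (x j * y j))).
  have sumM (f g : I -> R) : \sum_i \sum_j f i * g j = (\sum_i f i) * (\sum_j g j).
    by rewrite mulr_suml; apply: eq_bigr => i _; rewrite mulr_sumr.
  by rewrite !sumM; ring.
rewrite mulr_sumr -big_split -sumrB /=; apply: eq_bigr => i _.
rewrite mulr_sumr -big_split -sumrB /=; apply: eq_bigr => j _; ring.
Qed.

Lemma cauchy_schwarz_normc (I : finType) (x y : I -> R[i]) :
  normc (\sum_i x i * y i) ^+ 2 <=
    (\sum_i normc (x i) ^+ 2) * (\sum_i normc (y i) ^+ 2).
Proof.
apply: le_trans (cauchy_schwarz_sum _ _).
rewrite lerXn2r ?nnegrE ?normc_ge0//.
  by apply: sumr_ge0 => i _; rewrite mulr_ge0 ?normc_ge0.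
rewrite (le_trans (normc_sum_le _ _))//; apply: ler_sum => i _.
by rewrite Normc.normcM.
Qed.

Lemma Re_sum (I : Type) (r : seq I) (F : I -> R[i]) :
  complex.Re (\sum_(i <- r) F i) = \sum_(i <- r) complex.Re (F i).
Proof. by elim/big_rec2 : _ => // i x y _ <-; case: (F i); case: y. Qed.

Lemma Im_sum (I : Type) (r : seq I) (F : I -> R[i]) :
  complex.Im (\sum_(i <- r) F i) = \sum_(i <- r) complex.Im (F i).
Proof. by elim/big_rec2 : _ => // i x y _ <-; case: (F i); case: y. Qed.

Lemma Re_mul_real (z : R[i]) (x : R) : complex.Re (z * x%:C) = complex.Re z * x.
Proof. by case: z => a b /=; rewrite mulr0 subr0. Qed.

Lemma Im_mul_real (z : R[i]) (x : R) : complex.Im (z * x%:C) = complex.Im z * x.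
Proof. by case: z => a b /=; rewrite mulr0 add0r. Qed.

Lemma sqr_normc_poly n (a : 'I_n -> R[i]) (x : R) :
  normc (\sum_i a i * (x ^+ i)%:C) ^+ 2 =
  row_poly (fun i => complex.Re (a i)) x ^+ 2 + row_poly (fun i => complex.Im (a i)) x ^+ 2.
Proof.
rewrite sqr_normcE Re_sum Im_sum /row_poly.
by congr (_ ^+ 2 + _ ^+ 2); apply: eq_bigr => i _; rewrite ?Re_mul_real ?Im_mul_real.
Qed.

Lemma infinite_distinct_points (E : set R) n : infinite_set E ->
  exists2 x : 'I_n -> R, injective x & forall i, E (x i).
Proof.
move=> /infinite_set_fset => /(_ n) [B BE nB].
have nthB (i : 'I_n) : (i < size (finmap.enum_fset B))%N.
  by rewrite (leq_trans _ nB).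
exists (fun i => nth 0 (finmap.enum_fset B) i) => [i j /eqP|i].
  by rewrite nth_uniq ?finmap.fset_uniq// => /eqP/val_inj.
by apply: BE => /=; exact: mem_nth.
Qed.

(** If k functions reproduce the monomials of degree at most M on an infinite
    set, then the matrix of the coefficients has rank M + 1; in particular
    k >= M + 1.  At M + 1 distinct points the reproduction identity reads
    V = C * Psi with V an invertible Vandermonde matrix. *)
Lemma coefficient_matrix_row_free (E : set R) M k (C : 'M[R[i]]_(M.+1, k))
    (psi : 'I_k -> R -> R[i]) : infinite_set E ->
  (forall (m : 'I_M.+1) x, E x -> (x ^+ m)%:C = \sum_j C m j * psi j x) ->
  row_free C.
Proof.
move=> /(infinite_distinct_points M.+1) [x xinj Ex] CE.
pose V := Vandermonde M.+1 (\row_i (x i)%:C).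
have VE : V = C *m (\matrix_(j, l) psi j (x l)).
  apply/matrixP => m l; rewrite !mxE -rmorphXn/= CE//.
  by apply: eq_bigr => j _; rewrite mxE.
have Vu : V \in unitmx.
  rewrite unitmxE unitfE det_Vandermonde.
  apply/prodf_neq0 => i _; apply/prodf_neq0 => j ij.
  rewrite !mxE subr_eq0; apply/eqP => -[] /xinj ji.
  by rewrite ji ltnn in ij.
rewrite /row_free eqn_leq rank_leq_row /=.
by rewrite -[leqLHS](mxrank_unit Vu) VE mxrankM_maxl.
Qed.
End real_complex_sums.

(** * Square integrals of combinations of complex-valued functions *)

Section complex_combinations.
Context d (T : measurableType d) (R : realType) (mu : {measure set T -> \bar R}).
Context (I : finType) (psi : I -> T -> R[i]).
Notation normc := (@Normc.normc R).
Context (mRe : forall i, measurable_fun [set: T] (fun x => complex.Re (psi i x))).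
Context (mIm : forall i, measurable_fun [set: T] (fun x => complex.Im (psi i x))).

Lemma measurable_sqr_normc_comb (a : I -> R[i]) :
  measurable_fun [set: T] (fun x => (normc (\sum_i a i * psi i x) ^+ 2)%:E).
Proof.
apply/measurable_EFinP.
under eq_fun => x do rewrite sqr_normcE Re_sum Im_sum.
have RM (z w : R[i]) : complex.Re (z * w) =
    complex.Re z * complex.Re w - complex.Im z * complex.Im w by case: z; case: w.
have IM (z w : R[i]) : complex.Im (z * w) =
    complex.Re z * complex.Im w + complex.Im z * complex.Re w by case: z; case: w.
apply: measurable_funD; apply: measurable_funX; apply: measurable_sum => i.
  under eq_fun do rewrite RM.
  by apply: measurable_funB; apply: measurable_funM.
under eq_fun do rewrite IM.
by apply: measurable_funD; apply: measurable_funM.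
Qed.

(** The Cauchy-Schwarz inequality at each point of D, integrated over D. *)
Lemma integral_sqr_normc_comb_le (D : set T) (a : I -> R[i]) : measurable D ->
  (\int[mu]_(x in D) (normc (\sum_i a i * psi i x) ^+ 2)%:E <=
    (\sum_i normc (a i) ^+ 2)%:E *
      \sum_i \int[mu]_(x in D) (normc (psi i x) ^+ 2)%:E)%E.
Proof.
move=> mD.
have mpsi i : measurable_fun D (fun x => (normc (psi i x) ^+ 2)%:E).
  apply: measurable_funTS; apply/measurable_EFinP.
  under eq_fun => x do rewrite sqr_normcE.
  by apply: measurable_funD; apply: measurable_funX.
have s0 : 0 <= \sum_i normc (a i) ^+ 2.
  by apply: sumr_ge0 => i _; exact: sqr_ge0.
rewrite -ge0_integral_sum//; last first.
  by move=> i x _; rewrite lee_fin sqr_ge0.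
rewrite -ge0_integralZl_EFin//; first last.
- by apply: emeasurable_sum.
- by move=> x _; apply: sume_ge0 => i _; rewrite lee_fin sqr_ge0.
apply: ge0_le_integral => //.
- by move=> x _; rewrite lee_fin sqr_ge0.
- apply: measurable_funTS.
  exact: measurable_sqr_normc_comb.
- by apply: measurable_funeM; apply: emeasurable_sum.
- by move=> x _; rewrite sumEFin -EFinM lee_fin cauchy_schwarz_normc.
Qed.

End complex_combinations.

(** * Local lower bound on the unit interval *)

(** A finite family psi on [0,1), with psi i vanishing outside S i, which
    reproduces the monomials of degree at most M with coefficients c and whose
    supports have total measure exactly M + 1. *)
Section local_stability.
Context {R : realType} (I : finType) (M : nat).
Notation T := (lebesgueR R).
Notation nu := (@completed_lebesgue_measure R).
Notation normc := (@Normc.normc R).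
Context (S : I -> set R) (psi : I -> R -> R[i]) (c : 'I_M.+1 -> I -> R[i]).
Context (mS : forall i, measurable (S i)).
Context (psiS : forall i x, psi i x != 0 -> S i x).
Context (mRe : forall i, measurable_fun [set: T] (fun x : T => complex.Re (psi i x))).
Context (mIm : forall i, measurable_fun [set: T] (fun x : T => complex.Im (psi i x))).
Context (psi_repr : forall (m : 'I_M.+1) x, @unit_itv R x ->
  (x ^+ m)%:C = \sum_i c m i * psi i x).
Context (total_support : (\sum_i nu (unit_itv `&` S i) = M.+1%:R%:E)%E).

(** The indices whose support contains x. *)
Definition active (x : R) : {set I} := [set i | `[< S i x >]]%SET.

(** The points of [0,1) whose set of active indices is A. *)
Definition cell (A : {set I}) : set T := unit_itv `&` [set x | active x = A].

Lemma measurable_cell A : measurable (cell A).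
Proof.
apply: measurableI; first exact: measurable_unit_itv.
apply: borel_lebesgueR.
rewrite (_ : [set x | _] =
  \bigcap_(i in [set: I]) (if i \in A then S i else ~` S i)); last first.
  apply/seteqP; split=> [x /= <- i _|x /= h].
    by rewrite inE; case: asboolP.
  apply/setP => i; rewrite inE; have := h i Logic.I.
  by case: (i \in A) => ?; [apply/asboolP|apply/asboolPn].
apply: fin_bigcap_measurable; first exact: finite_finset.
by move=> i _; case: ifP => _ //; exact: measurableC.
Qed.

Lemma trivIset_cell : trivIset setT cell.
Proof.
apply/trivIsetP => A B _ _ AB; apply/seteqP; split => // x [[_ /= xA] [_ /= xB]].
by move/eqP: AB; apply; rewrite -xA.
Qed.

Lemma measure_cells (P : pred {set I}) :
  (\sum_(A | P A) nu (cell A) = nu (unit_itv `&` [set x | P (active x)]))%E.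
Proof.
rewrite -measure_finType_bigcup; [|exact: measurable_cell|exact: trivIset_cell].
congr (nu _); apply/seteqP; split => [x [A /= PA [x01 /= xA]]|x [x01 /= Px]].
  by split => //=; rewrite xA.
by exists (active x).
Qed.

Lemma measure_cells_mem (i : I) :
  (\sum_(A : {set I} | i \in A) nu (cell A) = nu (unit_itv `&` S i))%E.
Proof.
rewrite (measure_cells (fun A => i \in A)); congr (nu (_ `&` _)).
by apply/seteqP; split=> x /=; rewrite inE => /asboolP.
Qed.

Lemma cell_sub A : cell A `<=` unit_itv. Proof. by move=> x []. Qed.

Lemma cell_fin_num A : nu (cell A) \is a fin_num.
Proof.
rewrite ge0_fin_numE//; apply: (@le_lt_trans _ _ (nu (@unit_itv R))).
  apply: le_measure; rewrite ?inE; [exact: measurable_cell|exact: measurable_unit_itv|].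
  exact: cell_sub.
by rewrite unit_itv_measure ltry.
Qed.

Lemma cell_infinite A : (0 < nu (cell A))%E -> infinite_set (cell A : set R).
Proof. by move=> + /completed_lebesgue_finite0 A0; rewrite A0 ltxx. Qed.

(** On a cell only the active terms of a combination of the psi i remain. *)
Lemma sum_cell (A : {set I}) (x : R) (f : I -> R[i]) : cell A x ->
  \sum_i f i * psi i x = \sum_(j < #|A|) f (enum_val j) * psi (enum_val j) x.
Proof.
move=> [_ /= xA]; rewrite -(big_enum_val (A := mem A) (fun i => f i * psi i x)).
rewrite [RHS]big_mkcond; apply: eq_bigr => i _; case: ifPn => //.
rewrite -xA inE => /asboolPn Si; suff -> : psi i x = 0 by rewrite mulr0.
by apply/eqP; apply: contra_notT Si; exact: psiS.
Qed.

(** The coefficients of the monomials on the functions active in the cell A. *)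
Let coefm (A : {set I}) : 'M[R[i]]_(M.+1, #|A|) := \matrix_(m, j) c m (enum_val j).

Lemma coefm_row_free A : (0 < nu (cell A))%E -> row_free (coefm A).
Proof.
move=> /cell_infinite /coefficient_matrix_row_free.
apply=> m x Ax; rewrite psi_repr; last exact: (cell_sub Ax).
by rewrite (sum_cell _ Ax); apply: eq_bigr => j _; rewrite mxE.
Qed.

(** The mean of #|A| - (M + 1) over the cells is zero, and it is nonnegative
    on each cell of positive measure, hence it vanishes there. *)
Lemma card_active A : (0 < nu (cell A))%E -> #|A| = M.+1.
Proof.
have sum1 : \sum_A fine (nu (cell A)) = 1.
  apply: EFin_inj; rewrite -sumEFin; under eq_bigr do rewrite fineK ?cell_fin_num//.
  rewrite (measure_cells xpredT); apply: etrans (@unit_itv_measure R).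
  by congr (nu _); apply/seteqP; split => x; [case|split].
have sumcard : \sum_(A : {set I}) #|A|%:R * fine (nu (cell A)) = M.+1%:R.
  apply: EFin_inj; rewrite -total_support -sumEFin.
  under [RHS]eq_bigr => i _.
    rewrite -measure_cells_mem big_mkcond /=. over.
  rewrite exchange_big /=; apply: eq_bigr => B _.
  rewrite -big_mkcond /=; under [RHS]eq_bigr do rewrite -(fineK (cell_fin_num B)).
  by rewrite sumEFin sumr_const mulr_natl.
have sum0 : \sum_(A : {set I}) (#|A|%:R - M.+1%:R) * fine (nu (cell A)) = 0.
  under eq_bigr do rewrite mulrBl.
  by rewrite sumrB -mulr_sumr sum1 mulr1 sumcard subrr.
have ge0 (A' : {set I}) : 0 <= (#|A'|%:R - M.+1%:R) * fine (nu (cell A')) :> R.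
  have : (0 <= nu (cell A'))%E by [].
  rewrite le_eqVlt => /predU1P[<-|A'0]; first by rewrite mulr0.
  rewrite mulr_ge0 ?fine_ge0// subr_ge0 ler_nat.
  by rewrite -(eqP (coefm_row_free A'0)) rank_leq_col.
move=> A0; move/eqP : sum0; rewrite psumr_eq0// => /allP /(_ A).
rewrite mem_index_enum => /(_ isT) /=; rewrite mulf_eq0 subr_eq0 eqr_nat.
case/orP => [/eqP//|/eqP A1]; move: A0.
by rewrite -(fineK (cell_fin_num A)) A1 ltxx.
Qed.

(** If S i meets [0,1) in positive measure, then the coefficient of index i in
    any combination of the psi t is controlled by the square integral of the
    combination over [0,1): i is active on some cell of positive measure. *)
Lemma local_lower_bound (i : I) : (0 < nu (unit_itv `&` S i))%E ->
  exists2 alpha : R, 0 < alpha & forall d : I -> R[i],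
    ((alpha * normc (d i) ^+ 2)%:E <=
      \int[nu]_(x in unit_itv) (normc (\sum_t d t * psi t x) ^+ 2)%:E)%E.
Proof.
move=> Si0.
have [A iA A0] : exists2 A : {set I}, i \in A & (0 < nu (cell A))%E.
  apply: contrapT => h; move: Si0.
  rewrite -measure_cells_mem big1 ?ltxx// => A iA.
  apply/eqP; rewrite eq_le measure_ge0 andbT leNgt; apply/negP => A0.
  by apply: h; exists A.
have [alpha alpha0 lb] :=
  @row_poly_lower_bound R M.+1 _ (measurable_cell A) (@cell_sub A) A0.
(* kappa bounds the squared norm of column i of the coefficient matrix; the
   summand 1 makes it positive. *)
pose kappa : R := 1 + \sum_m normc (c m i) ^+ 2.
have kappa0 : 0 < kappa.
  by rewrite ltr_pwDl// sumr_ge0// => m _; exact: sqr_ge0.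
exists (alpha / kappa); first by rewrite divr_gt0.
move=> d.
(* coefm A is square of full rank, so d restricted to A is a combination a of
   its rows; a lists the coefficients of the polynomial equal to the
   combination on the cell. *)
have rfull : row_full (coefm A).
  rewrite /row_full (eqP (coefm_row_free A0)); apply/eqP.
  by rewrite card_active.
have /submxP[a da] : (\row_j d (enum_val j) <= coefm A)%MS by exact: submx_full.
have dE (j : 'I_#|A|) : d (enum_val j) = \sum_m a ord0 m * c m (enum_val j).
  have := congr1 (fun v : 'rV_#|A| => v ord0 j) da; rewrite !mxE => ->.
  by apply: eq_bigr => m _; rewrite mxE.
have combE x : cell A x ->
    \sum_t d t * psi t x = \sum_m a ord0 m * (x ^+ m)%:C.
  move=> Ax; rewrite (sum_cell _ Ax).
  under eq_bigr do rewrite dE mulr_suml.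
  rewrite exchange_big /=; apply: eq_bigr => m _.
  rewrite psi_repr; last exact: (cell_sub Ax).
  rewrite (sum_cell _ Ax) mulr_sumr; apply: eq_bigr => j _.
  by rewrite mulrA.
apply: (@le_trans _ _ (\int[nu]_(x in cell A) (normc (\sum_t d t * psi t x) ^+ 2)%:E)%E); last first.
  apply: ge0_subset_integral; [exact: measurable_cell|exact: measurable_unit_itv| | |].
  - by apply: measurable_funTS; exact: (measurable_sqr_normc_comb mRe mIm).
  - by move=> x _; rewrite lee_fin sqr_ge0.
  - exact: cell_sub.
have -> : (\int[nu]_(x in cell A) (normc (\sum_t d t * psi t x) ^+ 2)%:E =
   \int[nu]_(x in cell A) (row_poly (fun m => complex.Re (a ord0 m)) x ^+ 2)%:E +
   \int[nu]_(x in cell A) (row_poly (fun m => complex.Im (a ord0 m)) x ^+ 2)%:E)%E.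
  rewrite -ge0_integralD; first last.
  - by apply/measurable_EFinP; apply: measurable_funX; exact: measurable_row_poly.
  - by move=> x _; rewrite lee_fin sqr_ge0.
  - by apply/measurable_EFinP; apply: measurable_funX; exact: measurable_row_poly.
  - by move=> x _; rewrite lee_fin sqr_ge0.
  - exact: measurable_cell.
  apply: eq_integral => x /[!inE] Ax; rewrite -EFinD; congr (_%:E).
  by rewrite -sqr_normc_poly combE.
apply: le_trans (leeD (lb _) (lb _)).
rewrite -EFinD lee_fin -mulrDr -big_split /=.
rewrite mulrAC -mulrA ler_pM2l//.
under eq_bigr do rewrite -sqr_normcE.
rewrite ler_pdivrMr//.
rewrite -(enum_rankK_in iA iA) dE; apply: le_trans (cauchy_schwarz_normc _ _) _.
rewrite enum_rankK_in// ler_wpM2l//.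
  by apply: sumr_ge0 => m _; exact: sqr_ge0.
by rewrite lerDr.
Qed.

End local_stability.

(** * The finite family of shifts that meet the unit interval *)

(** A family phi whose supports lie in ]-K, K[; only its shifts by the integers
    from -K to K meet [0,1). *)
Section shifted_family.
Context {R : realType} (N K : nat).
Notation T := (lebesgueR R).
Notation nu := (@completed_lebesgue_measure R).
Notation normc := (@Normc.normc R).
Context (phi : 'I_N -> R -> R[i]).
Context (supp_bounded : forall n x, supp (phi n) x -> `|x| < K%:R).

(** The pair (n, i) stands for the shift of phi n by the integer i - K, with
    0 <= i <= 2 K. *)
Definition shift_index : finType := ('I_N * 'I_(K + K).+1)%type.

(** The integer by which the index i shifts. *)
Definition shift_val (i : 'I_(K + K).+1) : int := i%:Z - K%:Z.

(** The finite family of the shifts of the phi n. *)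
Definition shifted (t : shift_index) (x : R) : R[i] :=
  phi t.1 (x - (shift_val t.2)%:~R).

(** The support of the shifted function, as a shift of the support. *)
Definition shifted_supp (t : shift_index) : set R :=
  [set x | supp (phi t.1) (x - (shift_val t.2)%:~R)].

Lemma shift_val_inj : injective shift_val.
Proof. by move=> i j /addIr [] /val_inj. Qed.

Lemma supp_neq0 n x : phi n x != 0 -> supp (phi n) x.
Proof. by move=> phix; apply: subset_closure. Qed.

Lemma supp_measurable n : measurable (supp (phi n)).
Proof. by apply: closed_measurable; exact: closed_closure. Qed.

Lemma shift_val_surj (x : R) (k : int) : unit_itv x -> `|x - k%:~R| < K%:R ->
  exists i, shift_val i = k.
Proof.
rewrite /unit_itv /= in_itv/= => /andP[x0 x1]; rewrite ltr_norml => /andP[h1 h2].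
have k1 : k < K%:Z + 1 by rewrite -(ltr_int R) intrD; lra.
have k2 : - K%:Z < k by rewrite -(ltr_int R) rmorphN/=; lra.
have hk : (`|(k + K%:Z)%R|%N < (K + K).+1)%N by lia.
by exists (Ordinal hk); rewrite /shift_val/=; lia.
Qed.

(** On [0,1) the translate by j of a combination of the shifts of phi is a
    combination of the finite shifted family; j enters only the coefficients. *)
Lemma shift_comb_unit (c : 'I_N -> int -> R[i]) (j : int) (x : R) : unit_itv x ->
  shift_comb phi c (x - j%:~R) =
  \sum_(t : shift_index) c t.1 (shift_val t.2 - j) * shifted t x.
Proof.
move=> x01; rewrite /shift_comb.
rewrite (fsbigE [seq shift_val i - j | i <- enum 'I_(K + K).+1])//=; first last.
- move=> k _ kr; apply: big1 => n _.
  have [->|/supp_neq0/supp_bounded h] := eqVneq (phi n (x - j%:~R - k%:~R)) 0.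
    by rewrite mulr0.
  have [i ik] : exists i, shift_val i = k + j.
    by apply: (shift_val_surj x01); rewrite intrD opprD addrA addrAC.
  case/negP: kr; apply/mapP; exists i; first by rewrite mem_enum.
  by rewrite ik addrK.
- by rewrite map_inj_uniq ?enum_uniq// => i1 i2 /addIr /shift_val_inj.
rewrite big_map big_mkcond/= big_enum /=.
rewrite -(pair_bigA _ (fun n i => c n (shift_val i - j) * shifted (n, i) x)) /=.
rewrite exchange_big; apply: eq_bigr => i _.
rewrite mem_set//; apply: eq_bigr => n _; congr (_ * phi n _).
by rewrite intrD rmorphN/=; ring.
Qed.

(** The supports of the shifts of phi n cut [0,1) in pieces whose translates
    partition the support of phi n. *)
Lemma sum_shifted_supp n :
  (\sum_i nu (unit_itv `&` shifted_supp (n, i)) = nu (supp (phi n)))%E.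
Proof.
pose F i : set T := [set x : R | supp (phi n) x /\ unit_itv (x + (shift_val i)%:~R)].
have mF i : measurable (F i).
  apply: measurableI; first by apply: borel_lebesgueR; exact: supp_measurable.
  exact/measurable_shift/measurable_unit_itv.
have tF : trivIset setT F.
  apply/trivIsetP => i j _ _ ij; apply/seteqP; split => // x [[_ xi] [_ xj]].
  move/eqP : ij; apply; apply: shift_val_inj.
  by rewrite ((unit_itv_shiftP _ _).1 xi) ((unit_itv_shiftP _ _).1 xj).
rewrite (_ : supp (phi n) = \bigcup_(i in [set i | xpredT i]) F i); last first.
  apply/seteqP; split => [x sx|x [i _ []//]].
  have xf := (unit_itv_shiftP (- Num.floor x) x).2 erefl.
  have [i ik] : exists i, shift_val i = - Num.floor x.
    apply: (shift_val_surj xf); rewrite addrK.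
    exact: supp_bounded sx.
  by exists i => //; split => //; rewrite ik.
rewrite measure_finType_bigcup//; apply: eq_bigr => i _.
rewrite -[RHS](completed_lebesgue_shift (- (shift_val i)%:~R)).
by congr (nu _); apply/seteqP; split => x /=; rewrite /F /shifted_supp /= subrK => -[].
Qed.

End shifted_family.

(** * The two Riesz inequalities *)

Section square_norms.
Context {R : realType}.
Notation T := (lebesgueR R).
Notation nu := (@completed_lebesgue_measure R).
Notation normc := (@Normc.normc R).

Lemma L2normE (f : R -> R[i]) :
  (L2norm f = (\int[nu]_x (normc (f x) ^+ 2)%:E) `^ 2^-1)%E.
Proof.
rewrite /L2norm unlock; congr (_ `^ _)%E; apply: eq_integral => x _ /=.
by rewrite ger0_norm ?normc_ge0// powR_mulrn ?normc_ge0.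
Qed.

Lemma ell2_sqnorm_ge0 (c : int -> R[i]) : (0 <= ell2_sqnorm c)%E.
Proof. by apply: esum_ge0 => k _; rewrite lee_fin sqr_ge0. Qed.

Lemma ell2_norm_sqr (c : int -> R[i]) : in_ell2 c ->
  ((ell2_norm c ^+ 2)%:E = ell2_sqnorm c)%E.
Proof.
move=> c2; rewrite /ell2_norm sqr_sqrtr; last by rewrite fine_ge0// ell2_sqnorm_ge0.
by rewrite fineK// ge0_fin_numE// ell2_sqnorm_ge0.
Qed.

(** The coefficients seen by a fixed shift, as j varies, are all those of c. *)
Lemma ell2_sqnorm_reflect (c : int -> R[i]) (k : int) :
  (\esum_(j in [set: int]) (normc (c (k - j)) ^+ 2)%:E = ell2_sqnorm c)%E.
Proof.
rewrite /ell2_sqnorm [RHS](@reindex_esum R _ _ setT setT (fun j : int => k - j))//.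
split => //; first by move=> i j _ _ /addrI /oppr_inj.
by move=> j _; exists (k - j) => //; rewrite opprB addrC subrK.
Qed.

Lemma compact_abs_lt_nat (E : set R) : compact E ->
  exists K : nat, forall x, E x -> `|x| < K%:R.
Proof.
move=> /compact_bounded [B [_ hB]].
exists (Num.truncn (B + 1)).+1 => x Ex.
apply: le_lt_trans (truncnS_gt _).
by apply: hB => //; rewrite ltrDl.
Qed.

End square_norms.

Section riesz.
Context {R : realType} (N M : nat).
Notation T := (lebesgueR R).
Notation nu := (@completed_lebesgue_measure R).
Notation normc := (@Normc.normc R).
Context (phi : 'I_N -> R -> R[i]).
Context (phi_nz : forall n : 'I_N, nonzero_in_L2 (phi n)).
Context (phiL2 : forall n, in_L2 (phi n)).
Context (phi_repr : reproduces_polynomials phi M).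
Context (phi_size : support_size phi = (M.+1%:R)%:E).
Context (K : nat).
Context (supp_bounded : forall n x, supp (phi n) x -> `|x| < K%:R).

Let I := shift_index N K.
Let psi := @shifted R N K phi.
Let S := @shifted_supp R N K phi.

Let mphi_shift n (a : R) :
  measurable_fun [set: T] (fun x : T => complex.Re (phi n ((x : R) - a))) /\
  measurable_fun [set: T] (fun x : T => complex.Im (phi n ((x : R) - a))).
Proof.
have [mRe mIm _] := phiL2 n.
by split; [exact: (measurable_fun_shift (c := - a) mRe)|
           exact: (measurable_fun_shift (c := - a) mIm)].
Qed.

Let mRe (t : I) : measurable_fun [set: T] (fun x : T => complex.Re (psi t x)).
Proof. exact: (mphi_shift _ _).1. Qed.

Let mIm (t : I) : measurable_fun [set: T] (fun x : T => complex.Im (psi t x)).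
Proof. exact: (mphi_shift _ _).2. Qed.

Lemma psi_supp (t : I) (x : R) : psi t x != 0 -> S t x.
Proof. exact: supp_neq0. Qed.

Lemma measurable_S (t : I) : measurable (S t).
Proof.
have cs : continuous (fun x : R => x - (shift_val t.2)%:~R).
  by move=> x; apply: cvgB; [exact: cvg_id|exact: cvg_cst].
apply: closed_measurable; apply: (preimage_closed (f := fun x : R => x - (shift_val t.2)%:~R)).
  by move=> x _; exact: cs.
exact: closed_closure.
Qed.

Lemma total_S : (\sum_(t : I) nu (unit_itv `&` S t) = M.+1%:R%:E)%E.
Proof.
rewrite -phi_size /support_size.
rewrite -(pair_bigA _ (fun n i => nu (unit_itv `&` S (n, i)))) /=.
by apply: eq_bigr => n _; exact: sum_shifted_supp.
Qed.

(** Otherwise the support of phi n would be null, and phi n would vanish almost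
    everywhere. *)
Lemma supp_meets_unit n : exists i, (0 < nu (unit_itv `&` S (n, i)))%E.
Proof.
apply: contrapT => h; apply: (phi_nz (n := n)).
exists (supp (phi n)); split.
- exact: supp_measurable.
- have := sum_shifted_supp supp_bounded n.
  rewrite big1; first by move=> E; exact: esym E.
  move=> i _; apply/eqP; rewrite eq_le measure_ge0 andbT leNgt; apply/negP => ?.
  by apply: h; exists i.
- by move=> x /= xn0; apply: supp_neq0; apply/eqP.
Qed.

Lemma psi_repr : exists c : 'I_M.+1 -> I -> R[i],
  forall (m : 'I_M.+1) x, @unit_itv R x -> (x ^+ m)%:C = \sum_t c m t * psi t x.
Proof.
have /choice[c cP] : forall m : 'I_M.+1, exists c : 'I_N -> int -> R[i],
    forall x : R, (x ^+ m)%:C = shift_comb phi c x.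
  by move=> m; apply: phi_repr; rewrite -ltnS.
exists (fun m t => c m t.1 (shift_val t.2)) => m x x01.
rewrite cP -[x in LHS]subr0 -[0 in LHS]/((0 : int)%:~R) (shift_comb_unit supp_bounded)//.
by apply: eq_bigr => t _; rewrite subr0.
Qed.

Lemma measurable_sqr_shift_comb (c : 'I_N -> int -> R[i]) :
  measurable_fun [set: T] (fun x : T => (normc (shift_comb phi c x) ^+ 2)%:E).
Proof.
apply: measurable_fun_unit_translates => j.
apply: (eq_measurable_fun (fun x : T =>
    (normc (\sum_(t : I) c t.1 (shift_val t.2 - j) * psi t x) ^+ 2)%:E)).
  by move=> x /[!inE] x01; rewrite (shift_comb_unit supp_bounded).
apply: measurable_funTS.
exact: (measurable_sqr_normc_comb mRe mIm).
Qed.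

Lemma integral_sqr_shift_comb (c : 'I_N -> int -> R[i]) :
  (\int[nu]_x (normc (shift_comb phi c x) ^+ 2)%:E =
   \esum_(j in [set: int]) \int[nu]_(x in unit_itv)
      (normc (\sum_(t : I) c t.1 (shift_val t.2 - j) * psi t x) ^+ 2)%:E)%E.
Proof.
rewrite (integral_unit_partition (measurable_sqr_shift_comb c)); last first.
  by move=> x; rewrite lee_fin sqr_ge0.
apply: eq_esum => j _; apply: eq_integral => x /[!inE] x01.
by rewrite (shift_comb_unit supp_bounded).
Qed.

(** The lower Riesz inequality for the coefficients of one generator. *)
Lemma lower_bound_single n : exists2 alpha : R, 0 < alpha &
  forall c : 'I_N -> int -> R[i],
    (alpha%:E * ell2_sqnorm (c n) <=
     \int[nu]_x (normc (shift_comb phi c x) ^+ 2)%:E)%E.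
Proof.
have [i Si] := supp_meets_unit n.
have [c0 c0P] := psi_repr.
have [alpha alpha0 lb] :=
  local_lower_bound measurable_S psi_supp mRe mIm c0P total_S Si.
exists alpha => // c.
rewrite integral_sqr_shift_comb -(ell2_sqnorm_reflect (c n) (shift_val i)).
rewrite -esum_intZl; [|exact: ltW|by move=> j; rewrite lee_fin sqr_ge0].
apply: le_esum => j _; rewrite -EFinM.
exact: (lb (fun t => c t.1 (shift_val t.2 - j))).
Qed.

Lemma psi_energy_fin (t : I) :
  (\int[nu]_(x in unit_itv) (normc (psi t x) ^+ 2)%:E < +oo)%E.
Proof.
have [mR mI L2] := phiL2 t.1.
have mphi : measurable_fun [set: T] (fun x : T => (normc (phi t.1 x) ^+ 2)%:E).
  apply/measurable_EFinP; under eq_fun => x do rewrite sqr_normcE.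
  by apply: measurable_funD; apply: measurable_funX.
apply: (@le_lt_trans _ _ (\int[nu]_x (normc (phi t.1 x) ^+ 2)%:E)%E).
  rewrite -(integral_shift (- (shift_val t.2)%:~R) measurableT mphi); last first.
    by move=> x; rewrite lee_fin sqr_ge0.
  apply: ge0_subset_integral; first exact: measurable_unit_itv.
  - exact: measurable_shift.
  - exact: (measurable_fun_shift (c := - (shift_val t.2)%:~R) mphi).
  - by move=> x _; rewrite lee_fin sqr_ge0.
  - by [].
move: L2; rewrite L2normE; case: (\int[nu]_x _)%E => [r _||_].
- exact: ltry.
- by rewrite poweRyr ?invr_neq0// ltxx.
- by [].
Qed.

Lemma upper_bound : exists2 beta : R, 0 < beta &
  forall c : 'I_N -> int -> R[i],
    (\int[nu]_x (normc (shift_comb phi c x) ^+ 2)%:E <=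
     beta%:E * \sum_n ell2_sqnorm (c n))%E.
Proof.
pose B : \bar R := (\sum_(t : I) \int[nu]_(x in unit_itv) (normc (psi t x) ^+ 2)%:E)%E.
have B0 : (0 <= B)%E.
  by apply: sume_ge0 => t _; apply: integral_ge0 => x _; rewrite lee_fin sqr_ge0.
have Bfin : B \is a fin_num.
  by rewrite ge0_fin_numE//; apply: lte_sum_pinfty => t _; exact: psi_energy_fin.
pose b := fine B.
have b0 : 0 <= b by exact: fine_ge0.
exists (1 + b *+ (K + K).+1) => [|c]; first by rewrite ltr_pwDl// mulrn_wge0.
apply: (@le_trans _ _ ((b *+ (K + K).+1)%:E * \sum_n ell2_sqnorm (c n))%E); last first.
  rewrite lee_wpmul2r//; first by apply: sume_ge0 => n _; exact: ell2_sqnorm_ge0.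
  by rewrite lee_fin lerDr.
rewrite integral_sqr_shift_comb.
apply: (@le_trans _ _ (\esum_(j in [set: int])
    (b%:E * \sum_(t : I) (normc (c t.1 (shift_val t.2 - j)) ^+ 2)%:E))%E).
  apply: le_esum => j _.
  apply: le_trans (integral_sqr_normc_comb_le nu mRe mIm _ measurable_unit_itv) _.
  by rewrite -/B sumEFin muleC fineK.
rewrite esum_intZl//; last first.
  by move=> j; apply: sume_ge0 => t _; rewrite lee_fin sqr_ge0.
rewrite esum_sum; last by move=> j t _ _; rewrite lee_fin sqr_ge0.
under eq_bigr do rewrite ell2_sqnorm_reflect.
rewrite -(pair_bigA _ (fun n (i : 'I_(K + K).+1) => ell2_sqnorm (c n))) /=.
rewrite exchange_big /= sumr_const card_ord -[X in (_ * X <= _)%E]mule_natl.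
by rewrite muleA -EFinM mulr_natr.
Qed.

Lemma riesz_bounds : (1 <= N)%N -> generates_Riesz_basis phi.
Proof.
move=> N0.
have /choice[alpha aP] : forall n, exists alpha : R, 0 < alpha /\
    forall c : 'I_N -> int -> R[i],
      (alpha%:E * ell2_sqnorm (c n) <=
       \int[nu]_x (normc (shift_comb phi c x) ^+ 2)%:E)%E.
  by move=> n; have [a a0 aP] := lower_bound_single n; exists a.
have [beta beta0 bP] := upper_bound.
(* Adding the N inequalities ||c n||^2 <= Q / alpha n, where Q is the squared
   norm of the combination, bounds the sum of the ||c n||^2 by gamma * Q. *)
pose gamma := \sum_n (alpha n)^-1.
have gamma0 : 0 < gamma.
  rewrite /gamma (bigD1 (Ordinal N0))//= ltr_pwDl//.
    by rewrite invr_gt0 (aP _).1.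
  by apply: sumr_ge0 => n _; rewrite invr_ge0 ltW// (aP _).1.
have A0 : 0 < Num.sqrt gamma^-1 by rewrite sqrtr_gt0 invr_gt0.
exists (Num.sqrt gamma^-1), (Num.max (Num.sqrt gamma^-1) (Num.sqrt beta)).
split => // [|c c2]; first by rewrite le_max lexx.
set s := \sum_(n < N) ell2_norm (c n) ^+ 2.
have s0 : 0 <= s by apply: sumr_ge0 => n _; exact: sqr_ge0.
have sE : (s%:E = \sum_n ell2_sqnorm (c n))%E.
  by rewrite -sumEFin; apply: eq_bigr => n _; rewrite ell2_norm_sqr.
rewrite L2normE.
have := bP c; rewrite -sE -EFinM.
have : forall n, ((alpha n * ell2_norm (c n) ^+ 2)%:E <=
       \int[nu]_x (normc (shift_comb phi c x) ^+ 2)%:E)%E.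
  by move=> n; rewrite EFinM ell2_norm_sqr//; exact: (aP n).2.
have : (0 <= \int[nu]_x (normc (shift_comb phi c x) ^+ 2)%:E)%E.
  by apply: integral_ge0 => x _; rewrite lee_fin sqr_ge0.
case: (\int[nu]_x _)%E => [q| |]// q0 lo up; rewrite !lee_fin in q0 up.
have {}lo : gamma^-1 * s <= q.
  rewrite mulrC ler_pdivrMr// /gamma mulr_sumr; apply: ler_sum => n _.
  by rewrite ler_pdivlMr ?(aP n).1// mulrC -lee_fin.
rewrite poweR_EFin powR12_sqrt// !lee_fin -sqrtrM ?invr_ge0 ?(ltW gamma0)//.
split; first by rewrite ler_sqrt.
apply: (@le_trans _ _ (Num.sqrt beta * Num.sqrt s)).
  by rewrite -sqrtrM ?(ltW beta0)// ler_sqrt// mulr_ge0// ltW.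
by rewrite ler_wpM2r ?sqrtr_ge0// le_max lexx orbT.
Qed.

End riesz.

Theorem theorem2 (R : realType) (N M : nat) (phi : 'I_N -> R -> complex R) :
  (1 <= N)%N ->
  (forall n : 'I_N, nonzero_in_L2 (phi n)) ->
  shortest_support_basis phi M ->
  generates_Riesz_basis phi.
Proof.
move=> N0 phi_nz [phiL2 phi_cpt phi_repr phi_size].
have /choice[K KP] : forall n, exists K : nat, forall x, supp (phi n) x -> `|x| < K%:R.
  by move=> n; apply: compact_abs_lt_nat; exact: phi_cpt.
apply: (riesz_bounds phi_nz phiL2 phi_repr phi_size (K := \max_n K n)) => //.
move=> n x /KP /lt_le_trans; apply; rewrite ler_nat.
exact: leq_bigmax.
Qed.
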